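(* Let $G=(V,E)$ be a finite simple connected graph and let $V_1\subseteq V$. Let $d$ be the shortest-path metric of $G$ restricted to $V_1$ (every edge has length $1$). Then \[\mathcal{P}_G\cap\mathbb{R}^{V_1}=KR(V_1,d),\] where $\mathcal{P}_G\cap\mathbb{R}^{V_1}:=\{x\in\mathcal{P}_G : x_i=0 \text{ for all } i\notin V_1\}$.
   Context: For a graph $G=(V,E)$, the symmetric edge polytope is $\mathcal{P}_G:=\mathrm{conv}\{\mathbf{e}_v-\mathbf{e}_w,\ \mathbf{e}_w-\mathbf{e}_v : \{v,w\}\in E\}\subset\mathbb{R}^V$, where $(\mathbf{e}_v)_{v\in V}$ is the standard basis. For a finite metric space $(X,d)$, the Kantorovich--Rubinstein polytope is $KR(X,d):=\mathrm{conv}\{\frac{\mathbf{e}_i-\mathbf{e}_j}{d(i,j)} : i,j\in X\}\subset\mathbb{R}^X\subseteq\mathbb{R}^V$, where for $i=j$ the point is taken to be the origin $\mathbf{0}$.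
   Formalization: The formal theorem assumes that G has at least two vertices and that V_1 is nonempty; otherwise the equality can fail, since the convex hull of the empty set is empty (e.g. G a single vertex with V_1=V, or V_1 empty and G having an edge). *)

(* Defs.v *)
From mathcomp Require Import all_boot all_order all_algebra.
From mathcomp Require Import boolp classical_sets reals convex.

Set Implicit Arguments.
Unset Strict Implicit.
Unset Printing Implicit Defensive.

Import Order.TTheory GRing.Theory Num.Theory.

Local Open Scope classical_set_scope.
Local Open Scope ring_scope.

Definition conv_hull (R : realType) (E : lmodType R) (A : set E) : set E :=
  smallest (@convex_set R E) A.

Definition basis_vec (R : realType) (V : finType) (v : V) : {ffun V -> R^o} :=
  [ffun w => (w == v)%:R].

Section Graph.
Variables (V : finType) (e : rel V).

Definition connected_graph := forall v w : V, connect e v w.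

Definition has_walk (v w : V) (n : nat) : bool :=
  [exists p : n.-tuple V, path e v p && (last v p == w)].

Lemma connect_has_walk v w : connect e v w -> exists n, has_walk v w n.
Proof.
move=> /connectP[p ep ->]; exists (size p).
by apply/existsP; exists (in_tuple p); rewrite ep eqxx.
Qed.

Definition graph_dist (e_conn : connected_graph) (v w : V) : nat :=
  ex_minn (connect_has_walk (e_conn v w)).

End Graph.

Definition sym_edge_polytope (R : realType) (V : finType) (e : rel V) :
    set {ffun V -> R^o} :=
  conv_hull [set x | exists v w : V, e v w /\
    (x = basis_vec R v - basis_vec R w \/ x = basis_vec R w - basis_vec R v)].

Arguments sym_edge_polytope R {V} e _.

(* [X : {set V}] carries the metric [d], of which only the values on [X] matter;
   R^X is viewed inside R^V. *)
Definition KR_polytope (R : realType) (V : finType) (X : {set V})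
    (d : V -> V -> R) : set {ffun V -> R^o} :=
  conv_hull [set x | exists i j : V, [/\ i \in X, j \in X &
    x = if i == j then 0 else (d i j)^-1 *: (basis_vec R i - basis_vec R j)]].

Arguments KR_polytope {R V} X d _.

(* Main.v *)
Require Import Defs.
From mathcomp Require Import all_boot all_order all_algebra.
From mathcomp Require Import interval_inference.
From mathcomp Require Import boolp classical_sets reals convex.
From mathcomp Require Import ring lra.

(** The symmetric edge polytope is the Kantorovich-Rubinstein polytope of the
    whole vertex set, because [(e_i - e_j) / d(i, j)] is the average of the edge
    vectors along a shortest path from [i] to [j]. It is therefore enough to see
    that, for an arbitrary metric, the hyperplane [x_k = 0] cuts [KR(X, d)] in
    [KR(X \ {k}, d)]. The points of [KR(X, d)] are the sums
    [\sum_(i, j) f(i, j) (e_i - e_j)] over the nonnegative flows [f] on [X * X]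
    of cost [\sum_(i, j) f(i, j) d(i, j)] at most [1]. If [x_k = 0], the inflow
    and the outflow of [f] at [k] have the same mass, and a coupling of the two
    sends this mass directly from its sources to its targets. As
    [(e_i - e_k) + (e_k - e_j) = e_i - e_j], this does not move the point; by
    the triangle inequality it does not raise the cost. *)

Set Implicit Arguments.
Unset Strict Implicit.
Unset Printing Implicit Defensive.

Import Order.TTheory GRing.Theory Num.Theory.

Local Open Scope classical_set_scope.
Local Open Scope ring_scope.

Lemma convex_setP (R : numDomainType) (E : lmodType R) (A : set E) :
  @convex_set R E A <-> forall x y (t : R), 0 <= t -> t <= 1 -> A x -> A y ->
    A (t *: x + (1 - t) *: y).
Proof.
split=> [cA x y t t0 t1 Ax Ay|cA x y t /set_mem Ax /set_mem Ay].
  by have /set_mem := cA x y (Itv01 t0 t1) (mem_set Ax) (mem_set Ay).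
by apply/mem_set/cA.
Qed.

Section ConvexCombinations.
Variables (R : numFieldType) (E : lmodType R).
Implicit Types (A : set E) (x y : E).

Lemma convex_set_weightedD A a b x y : @convex_set R E A ->
  0 <= a -> 0 <= b -> A x -> A y ->
  exists2 z, A z & a *: x + b *: y = (a + b) *: z.
Proof.
move=> /convex_setP cA a0 b0 Ax Ay.
have [/eqP|ab0] := eqVneq (a + b) 0.
  rewrite paddr_eq0 // => /andP[/eqP -> /eqP ->].
  by exists x; rewrite // addr0 !scale0r addr0.
have ab_gt0 : 0 < a + b by rewrite lt_neqAle eq_sym ab0 addr_ge0.
exists ((a / (a + b)) *: x + (1 - a / (a + b)) *: y).
  apply: cA => //; first exact: divr_ge0 (ltW ab_gt0).
  by rewrite ler_pdivrMr // mul1r lerDl.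
by rewrite scalerDr !scalerA; congr (_ *: _ + _ *: _); field.
Qed.

Lemma convex_set_sum_le1 A (I : finType) (P : pred I) (c : I -> R)
    (a : I -> E) :
  @convex_set R E A -> A 0 -> (forall i, 0 <= c i) ->
  (forall i, P i -> A (a i)) ->
  \sum_(i | P i) c i <= 1 -> A (\sum_(i | P i) c i *: a i).
Proof.
move=> cA A0 c0 Aa c1.
have [z Az ->] : exists2 z, A z &
    \sum_(i | P i) c i *: a i = (\sum_(i | P i) c i) *: z.
  elim: (index_enum I) => [|i r [z Az IH]].
    by exists 0; rewrite // !big_nil scale0r.
  rewrite !big_cons IH; case: ifP => [Pi|_]; last by exists z.
  by apply: convex_set_weightedD => //; [exact: sumr_ge0|exact: Aa].
move/convex_setP: cA => /(_ z 0 _ (sumr_ge0 _ (fun i _ => c0 i)) c1 Az A0).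
by rewrite scaler0 addr0.
Qed.

End ConvexCombinations.

Section ConvexHull.
Variables (R : realType) (E : lmodType R).
Implicit Types (A B : set E) (x : E).

Lemma conv_hull_convex A : @convex_set R E (conv_hull A).
Proof.
apply/convex_setP => x y t t0 t1 Ax Ay B [cB AB].
by move/convex_setP: (cB); apply => //; [apply: Ax|apply: Ay].
Qed.

Lemma sub_conv_hull A B : A `<=` B -> conv_hull A `<=` conv_hull B.
Proof. by apply: sub_smallest2r; exact: conv_hull_convex. Qed.

Lemma conv_hull_finite0 (I : finType) (D : {set I}) (a : I -> E) :
  (exists2 i, i \in D & a i = 0) ->
  conv_hull [set a i | i in [set` D]] = [set x | exists c : I -> R,
    [/\ forall i, 0 <= c i, \sum_(i in D) c i <= 1 &
        x = \sum_(i in D) c i *: a i]].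
Proof.
move=> [o oD ao]; apply/seteqP; split.
  apply: smallest_sub => [|_ [i iD <-]].
    apply/convex_setP => x y t t0 t1 [c [c0 c1 ->]] [c' [c'0 c'1 ->]].
    exists (fun i => t * c i + (1 - t) * c' i); split.
    - by move=> i; rewrite addr_ge0 // mulr_ge0 // subr_ge0.
    - by rewrite big_split -!mulr_sumr /=; nra.
    - rewrite !scaler_sumr -big_split; apply: eq_bigr => i _ /=.
      by rewrite !scalerA scalerDl.
  exists (fun j => (j == i)%:R); split=> //.
    by rewrite (big_setD1 i) //= eqxx big1 ?addr0 // => j /setD1P[/negPf ->].
  rewrite (big_setD1 i) //= eqxx scale1r big1 ?addr0 // => j /setD1P[/negPf ->].
  by rewrite scale0r.
move=> x [c [c0 c1 ->]]; apply: convex_set_sum_le1 => //.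
- exact: conv_hull_convex.
- by apply: sub_gen_smallest; exists o.
- by move=> i iD; apply: sub_gen_smallest; exists i.
Qed.

End ConvexHull.

Section FlowSum.
Variables (R : pzRingType) (V : finType) (E : lmodType R).
Implicit Types (X : {set V}) (f g : V -> V -> R) (a b : V -> V -> E).

Definition flow_sum X f a : E := \sum_(i in X) \sum_(j in X) f i j *: a i j.

Lemma flow_sumDl X f g a :
  flow_sum X (fun i j => f i j + g i j) a = flow_sum X f a + flow_sum X g a.
Proof.
rewrite -big_split; apply: eq_bigr => i _; rewrite -big_split.
by apply: eq_bigr => j _; rewrite scalerDl.
Qed.

Lemma flow_sumDr X f a b :
  flow_sum X f (fun i j => a i j + b i j) = flow_sum X f a + flow_sum X f b.
Proof.
rewrite -big_split; apply: eq_bigr => i _; rewrite -big_split.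
by apply: eq_bigr => j _; rewrite scalerDr.
Qed.

Lemma flow_sum_setD1 X k f a : k \in X ->
  flow_sum X f a = f k k *: a k k +
    (\sum_(i in X :\ k) f i k *: a i k + \sum_(j in X :\ k) f k j *: a k j) +
    flow_sum (X :\ k) f a.
Proof.
move=> kX; rewrite /flow_sum (big_setD1 k) //= (big_setD1 k) //=.
rewrite [X in _ + X](eq_bigr _ (fun i _ => big_setD1 k kX)) big_split /=.
by rewrite -!addrA; congr (_ + _); rewrite addrCA.
Qed.

End FlowSum.

Section ProductCoupling.
Variables (R : numFieldType) (V : finType) (X : {set V}) (u v : V -> R).

(* Nonnegative marginals of total mass [0] vanish, so that the division by [0]
   is harmless. *)
Definition product_coupling i j : R := u i * v j / \sum_(l in X) u l.

Hypotheses (u_ge0 : forall i, 0 <= u i) (v_ge0 : forall j, 0 <= v j).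

Lemma product_coupling_ge0 i j : 0 <= product_coupling i j.
Proof. by rewrite divr_ge0 ?mulr_ge0 ?sumr_ge0. Qed.

Hypothesis mass_eq : \sum_(i in X) u i = \sum_(j in X) v j.

Lemma product_coupling_suml i : i \in X ->
  \sum_(j in X) product_coupling i j = u i.
Proof.
move=> iX; rewrite -mulr_suml -mulr_sumr -mass_eq.
have [u0|/mulfK //] := eqVneq (\sum_(l in X) u l) 0.
by rewrite (psumr_eq0P _ u0) // !mul0r.
Qed.

Lemma product_coupling_sumr j : j \in X ->
  \sum_(i in X) product_coupling i j = v j.
Proof.
move=> jX; rewrite -!mulr_suml mulrAC mass_eq.
have [v0|v0] := eqVneq (\sum_(l in X) v l) 0; last by rewrite divff // mul1r.
by rewrite (psumr_eq0P _ v0) // mulr0.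
Qed.

Lemma flow_sum_product_coupling (E : lmodType R) (a b : V -> E) :
  flow_sum X product_coupling (fun i j => a i + b j) =
  \sum_(i in X) u i *: a i + \sum_(j in X) v j *: b j.
Proof.
rewrite flow_sumDr; congr (_ + _).
  by apply: eq_bigr => i iX; rewrite -scaler_suml product_coupling_suml.
rewrite /flow_sum exchange_big.
by apply: eq_bigr => j jX; rewrite -scaler_suml product_coupling_sumr.
Qed.

End ProductCoupling.

Section Bypass.
Variables (R : numFieldType) (V : finType).
Implicit Types (X : {set V}) (f : V -> V -> R).

Definition bypass X k f i j : R :=
  f i j + product_coupling (X :\ k) (f^~ k) (f k) i j.

Lemma bypass_ge0 X k f : (forall i j, 0 <= f i j) ->
  forall i j, 0 <= bypass X k f i j.
Proof. by move=> f0 i j; rewrite addr_ge0 // product_coupling_ge0. Qed.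

Lemma flow_sum_bypass (E : lmodType R) X k f (a : V -> V -> E) : k \in X ->
  (forall i j, 0 <= f i j) ->
  \sum_(i in X :\ k) f i k = \sum_(j in X :\ k) f k j ->
  flow_sum X f a = f k k *: a k k + flow_sum (X :\ k) (bypass X k f) a +
    flow_sum (X :\ k) (product_coupling (X :\ k) (f^~ k) (f k))
      (fun i j => a i k + a k j - a i j).
Proof.
move=> kX f0 balanced; rewrite (flow_sum_setD1 _ _ kX) flow_sumDl.
rewrite -(flow_sum_product_coupling _ _ balanced) //.
rewrite -!addrA; congr (_ + _); rewrite addrC; congr (_ + _).
rewrite -flow_sumDr; apply: eq_bigr => i _; apply: eq_bigr => j _.
by rewrite subrKC.
Qed.

End Bypass.

Section Dipole.
Variables (R : realType) (V : finType).
Implicit Types (X : {set V}) (f : V -> V -> R) (i j k : V).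

Definition dipole i j : {ffun V -> R^o} := basis_vec R i - basis_vec R j.

Lemma dipoleE i j k : dipole i j k = (k == i)%:R - (k == j)%:R.
Proof. by rewrite !ffunE. Qed.

Lemma dipolexx i : dipole i i = 0.
Proof. exact: subrr. Qed.

Lemma dipoleN i j : - dipole i j = dipole j i.
Proof. exact: opprB. Qed.

Lemma dipoleD i j k : dipole i k + dipole k j = dipole i j.
Proof. by rewrite /dipole addrA subrK. Qed.

Lemma flow_sum_dipoleE X f k :
  flow_sum X f dipole k = flow_sum X f (fun i j => dipole i j k).
Proof.
rewrite sum_ffunE; apply: eq_bigr => i _; rewrite sum_ffunE.
by apply: eq_bigr => j _; rewrite ffunE.
Qed.

Lemma flow_sum_dipole_notin X f k : k \notin X -> flow_sum X f dipole k = 0.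
Proof.
move=> kX; have kF i : i \in X -> (k == i) = false.
  by move=> iX; apply: contraNF kX => /eqP ->.
rewrite flow_sum_dipoleE /flow_sum big1 // => i iX; rewrite big1 // => j jX.
by rewrite dipoleE !kF // subrr scaler0.
Qed.

Lemma flow_sum_dipole_in X f k : k \in X ->
  flow_sum X f dipole k =
  \sum_(j in X :\ k) f k j - \sum_(i in X :\ k) f i k.
Proof.
move=> kX; rewrite flow_sum_dipoleE (flow_sum_setD1 _ _ kX) dipolexx ffunE.
rewrite -flow_sum_dipoleE flow_sum_dipole_notin ?setD11 // scaler0 addr0 add0r.
rewrite addrC -sumrN; congr (_ + _).
  apply: eq_bigr => j /setD1P[/negPf jk _].
  by rewrite dipoleE eqxx eq_sym jk subr0 [LHS]mulr1.
apply: eq_bigr => i /setD1P[/negPf ik _].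
by rewrite dipoleE eqxx eq_sym ik sub0r [LHS]mulrN1.
Qed.

End Dipole.

Section KantorovichRubinstein.
Variables (R : realType) (V : finType) (d : V -> V -> R).
Implicit Types (X Y : {set V}) (x : {ffun V -> R^o}).

Definition molecule (p : V * V) : {ffun V -> R^o} :=
  (d p.1 p.2)^-1 *: dipole R p.1 p.2.

Hypothesis d_ge0 : forall i j, 0 <= d i j.
Hypothesis d_gt0 : forall i j, i != j -> 0 < d i j.

Lemma KR_polytope_moleculesE X :
  KR_polytope X d = conv_hull [set molecule p | p in [set` finset.setX X X]].
Proof.
have moleculeE i j :
    molecule (i, j) = if i == j then 0 else (d i j)^-1 *: dipole R i j.
  by rewrite /molecule; case: eqVneq => // ->; rewrite dipolexx scaler0.
congr conv_hull; apply/seteqP; split=> [_ [i [j [iX jX ->]]]|_ [[i j] + <-]].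
  by exists (i, j); rewrite ?moleculeE //= inE iX jX.
by rewrite /= inE moleculeE /= => /andP[iX jX]; exists i, j.
Qed.

Lemma KR_polytopeP X x : (0 < #|X|)%N ->
  KR_polytope X d x <-> exists f : V -> V -> R, [/\ forall i j, 0 <= f i j,
    flow_sum X f (d : V -> V -> R^o) <= 1 & x = flow_sum X f (@dipole R V)].
Proof.
move=> /card_gt0P[o oX].
have sum_setXX (W : nmodType) (F : V * V -> W) :
    \sum_(p in finset.setX X X) F p = \sum_(i in X) \sum_(j in X) F (i, j).
  by rewrite pair_big /=; apply: eq_big => [p|[]]; rewrite ?inE.
rewrite KR_polytope_moleculesE conv_hull_finite0; last first.
  by exists (o, o); rewrite ?inE ?oX // /molecule dipolexx scaler0.
split=> [[c [c0 c1 ->]]|[f [f0 f1 ->]]].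
  exists (fun i j => c (i, j) / d i j); rewrite !sum_setXX in c1 *; split.
  - by move=> i j; rewrite divr_ge0.
  - apply: le_trans c1; apply: ler_sum => i _; apply: ler_sum => j _.
    rewrite /GRing.scale /=.
    by have [->|d0] := eqVneq (d i j) 0; rewrite ?mulr0 ?divfK.
  - by apply: eq_bigr => i _; apply: eq_bigr => j _; rewrite scalerA.
exists (fun p => f p.1 p.2 * d p.1 p.2); rewrite !sum_setXX; split=> //.
  by move=> p; rewrite mulr_ge0.
apply: eq_bigr => i _; apply: eq_bigr => j _.
have [->|ij] := eqVneq i j; first by rewrite /molecule dipolexx !scaler0.
by rewrite scalerA mulfK // gt_eqF // d_gt0.
Qed.

Lemma KR_polytopeS X Y : X \subset Y -> KR_polytope X d `<=` KR_polytope Y d.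
Proof.
move=> /fintype.subsetP XY; apply: sub_conv_hull => _ [i [j [iX jX ->]]].
by exists i, j; split; rewrite ?XY.
Qed.

Hypothesis d_triangle : forall i j k, d i k <= d i j + d j k.

Lemma KR_polytope_setD1 X k x : k \in X -> (0 < #|X :\ k|)%N ->
  KR_polytope X d x -> x k = 0 -> KR_polytope (X :\ k) d x.
Proof.
move=> kX Xk_gt0; have X_gt0 : (0 < #|X|)%N by apply/card_gt0P; exists k.
case/(KR_polytopeP _ X_gt0)=> f [f0 f1 ->].
rewrite flow_sum_dipole_in // => /subr0_eq /esym balanced.
apply/KR_polytopeP => //; exists (bypass X k f); split.
- exact: bypass_ge0.
- apply: le_trans f1; rewrite (flow_sum_bypass _ kX f0 balanced).
  rewrite -addrA addrCA lerDl addr_ge0 ?mulr_ge0 //.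
  apply: sumr_ge0 => i _; apply: sumr_ge0 => j _.
  by rewrite mulr_ge0 ?product_coupling_ge0 // subr_ge0.
- rewrite (flow_sum_bypass _ kX f0 balanced) dipolexx scaler0 add0r.
  rewrite [X in _ + X]big1 ?addr0 // => i _; rewrite big1 // => j _.
  by rewrite dipoleD subrr scaler0.
Qed.

Lemma KR_polytope_coordinate_section X Y : Y \subset X -> (0 < #|Y|)%N ->
  [set x | KR_polytope X d x /\ forall i, i \notin Y -> x i = 0] =
  KR_polytope Y d.
Proof.
move=> YX Y_gt0; apply/seteqP; split=> [x [+ x0]|x KRx]; last first.
  split; first exact: KR_polytopeS KRx.
  case/(KR_polytopeP _ Y_gt0): KRx => f [_ _ ->] i.
  exact: flow_sum_dipole_notin.
have [n Xn] := ubnP #|X|; elim: n => // n IH in X Xn YX * => KRx.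
have [XY|/subsetPn[k kX kY]] := boolP (X \subset Y).
  exact: KR_polytopeS KRx.
have YXk : Y \subset X :\ k by rewrite subsetD1 YX.
apply: (IH (X :\ k)) => //; first by rewrite (cardsD1 k) kX in Xn.
apply: KR_polytope_setD1 => //; last exact: x0.
exact: leq_trans Y_gt0 (subset_leq_card YXk).
Qed.

End KantorovichRubinstein.

Section GraphDistance.
Variables (V : finType) (e : rel V) (e_conn : connected_graph e).

Lemma graph_dist_path v w :
  exists p, [/\ path e v p, last v p = w & size p = graph_dist e_conn v w].
Proof.
rewrite /graph_dist; case: ex_minnP => n /existsP[p /andP[ep /eqP lp]] _.
by exists p; rewrite size_tuple.
Qed.

Lemma graph_dist_le v p : path e v p ->
  (graph_dist e_conn v (last v p) <= size p)%N.
Proof.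
move=> ep; rewrite /graph_dist; case: ex_minnP => n _; apply.
by apply/existsP; exists (in_tuple p); rewrite ep eqxx.
Qed.

Lemma graph_dist_gt0 v w : v != w -> (0 < graph_dist e_conn v w)%N.
Proof.
by have [[|x p] [_ /= <- <-]] := graph_dist_path v w; rewrite ?eqxx.
Qed.

Lemma graph_dist_triangle u v w :
  (graph_dist e_conn u w <= graph_dist e_conn u v + graph_dist e_conn v w)%N.
Proof.
have [p [ep lp <-]] := graph_dist_path u v.
have [q [eq lq <-]] := graph_dist_path v w.
have := @graph_dist_le u (p ++ q).
by rewrite cat_path last_cat size_cat lp ep eq lq => /(_ isT).
Qed.

Lemma graph_dist_edge v w : v != w -> e v w -> graph_dist e_conn v w = 1%N.
Proof.
move=> vw evw; apply/eqP; rewrite eqn_leq graph_dist_gt0 // andbT.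
by have := @graph_dist_le v [:: w]; rewrite /= evw => ->.
Qed.

Lemma connected_graph_has_edge : (1 < #|V|)%N -> exists v w, e v w.
Proof.
move=> /card_gt1P[v [w [_ _ vw]]].
have [[|x p] [/= ep lp _]] := graph_dist_path v w.
  by rewrite lp eqxx in vw.
by exists v, x; case/andP: ep.
Qed.

End GraphDistance.

Section SymEdgePolytope.
Variables (R : realType) (V : finType) (e : rel V).
Local Notation P := (sym_edge_polytope R e).

Lemma sym_edge_polytope_edge v w : e v w || e w v -> P (dipole R v w).
Proof.
case/orP=> [vw|wv]; apply: sub_gen_smallest.
  by exists v, w; split; [|left].
by exists w, v; split; [|right].
Qed.

Lemma sym_edge_polytope0 v w : e v w -> P 0.
Proof.
move=> vw.
have Pvw : P (dipole R v w) by apply: sym_edge_polytope_edge; rewrite vw.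
have Pwv : P (dipole R w v) by apply: sym_edge_polytope_edge; rewrite vw orbT.
have [z Pz] :=
  convex_set_weightedD (@conv_hull_convex _ _ _) ler01 ler01 Pvw Pwv.
rewrite !scale1r dipoleD dipolexx => /esym/eqP.
by rewrite -mulr2n scaler_eq0 pnatr_eq0 /= => /eqP <-.
Qed.

Lemma sym_edge_polytope_path v p : P 0 -> path e v p ->
  P ((size p)%:R^-1 *: dipole R v (last v p)).
Proof.
move=> P0 /(pathP v) ep; set n := size p.
pose q i := nth v (v :: p) i.
have <- : \sum_(i < n) n%:R^-1 *: dipole R (q i) (q i.+1) =
    n%:R^-1 *: dipole R v (last v p).
  rewrite -scaler_sumr; congr (_ *: _).
  under eq_bigr do rewrite -dipoleN.
  rewrite sumrN -(big_mkord predT (fun i => dipole R (q i.+1) (q i))).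
  rewrite (telescope_sumr (fun i => basis_vec R (q i))) // opprB.
  by rewrite (last_nth v).
apply: convex_set_sum_le1 => //; first exact: conv_hull_convex.
  by move=> i _; apply: sym_edge_polytope_edge; rewrite ep.
rewrite sumr_const card_ord -[_^-1 *+ _]mulr_natl.
by have [->|n0] := eqVneq n 0%N; rewrite ?mul0r // mulfV ?pnatr_eq0.
Qed.

Variable e_conn : connected_graph e.
Local Notation d := (fun i j => (graph_dist e_conn i j)%:R : R).

Lemma KR_polytope_edge (X : {set V}) v w : v \in X -> w \in X -> e v w ->
  KR_polytope X d (dipole R v w).
Proof.
move=> vX wX vw; apply: sub_gen_smallest; exists v, w; split=> //.
have [->|v_neq_w] := eqVneq v w; first exact: dipolexx.
by rewrite graph_dist_edge // invr1 scale1r.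
Qed.

Lemma sym_edge_polytope_KR : symmetric e -> (1 < #|V|)%N ->
  P = KR_polytope [set: V]%SET d.
Proof.
move=> e_sym V_gt1; apply/seteqP.
split; apply: smallest_sub; try exact: conv_hull_convex.
  by move=> _ [v [w [vw [|] ->]]]; apply: KR_polytope_edge; rewrite // e_sym.
have [v [w /sym_edge_polytope0 P0]] := connected_graph_has_edge e_conn V_gt1.
move=> _ [i [j [_ _ ->]]]; case: eqVneq => // _.
have [p [ep <- <-]] := graph_dist_path e_conn i j.
exact: sym_edge_polytope_path.
Qed.

End SymEdgePolytope.

Unset Implicit Arguments.

Theorem theorem2p5 (R : realType) (V : finType) (e : rel V)
    (e_sym : symmetric e) (e_irr : irreflexive e)
    (e_conn : connected_graph e) (V_gt1 : (1 < #|V|)%N)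
    (V1 : {set V}) (V1_gt0 : (0 < #|V1|)%N) :
  [set x | sym_edge_polytope R e x /\ forall i : V, i \notin V1 -> x i = 0] =
  KR_polytope V1 (fun i j => (graph_dist e_conn i j)%:R : R).
Proof.
rewrite (sym_edge_polytope_KR R e_conn e_sym V_gt1).
apply: KR_polytope_coordinate_section => // [i j ij|i j k].
  by rewrite ltr0n graph_dist_gt0.
by rewrite -natrD ler_nat graph_dist_triangle.
Qed.
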